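(* Let $G=(V,E)$ be a finite simple graph and $\lambda\in\mathbb{Z}_{>0}^V$. Then \[ \widetilde{\chi}_G^\lambda \left( q, \frac{ 1 }{ 1-q } \right) \;=\; \sum_{\substack{\text{proper colorings}\\ c\,:\,V\to \mathbb{Z}_{ > 0 } }} q^{ \sum_{ v \in V } \lambda_v c(v) }, \] where the left side is the rational function in $q$ obtained by substituting $x=\frac1{1-q}$, and the equality is as formal (Laurent) power series in $q$. Consequently, \[ \widetilde{\chi}_G^{\mathbf 1} \left( q, \frac{ 1 }{ 1-q } \right) \;=\; X_G \left( q, q^2, q^3, \dots \right), \] where $\mathbf 1\in\mathbb{Z}^V$ is the all-ones vector.
   Context: A coloring $c$ is proper if $c(v)\ne c(w)$ whenever $vw\in E$. $\chi_G^\lambda(q,n):=\sum_c q^{\sum_v\lambda_v c(v)}$ over proper colorings $c:V\to\{1,\dots,n\}$; $\widetilde{\chi}^\lambda_G(q,x)$ is the unique polynomial in $\mathbb{Q}(q)[x]$ with $\widetilde{\chi}^\lambda_G(q,[n]_q)=\chi_G^\lambda(q,n)$ for all positive integers $n$, where $[n]_q=\frac{1-q^n}{1-q}$. Stanley's chromatic symmetric function is $X_G(x_1,x_2,\dots):=\sum_{c} x_1^{\#c^{-1}(1)}x_2^{\#c^{-1}(2)}\cdots$, summed over proper colorings $c:V\to\mathbb{Z}_{>0}$. *)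

(* Defs.v *)
From HB Require Import structures.
From mathcomp Require Import all_boot all_order all_algebra.
From mathcomp Require Import finmap.
From mathcomp Require Import boolp classical_sets functions cardinality fsbigop.
From mathcomp Require Import zify.

Set Implicit Arguments.
Unset Strict Implicit.
Unset Printing Implicit Defensive.

Import Order.TTheory GRing.Theory Num.Theory.
Local Open Scope ring_scope.
Local Open Scope classical_set_scope.

Definition ratfrac := {fraction {poly rat}}.
HB.instance Definition _ := GRing.Field.on ratfrac.

Definition to_ratfrac (p : {poly rat}) : ratfrac := tofrac p.
HB.instance Definition _ := GRing.RMorphism.copy to_ratfrac (@tofrac {poly rat}).

Definition qvar : ratfrac := to_ratfrac 'X.

Definition qint (n : nat) : ratfrac := (1 - qvar ^+ n) / (1 - qvar).

(* A formal series is its coefficient function m |-> f m, where m ranges over a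
   type M of monomials.  The sum of a summable family is taken
   coefficientwise; [\sum_(i \in A)] is 0 on infinite supports, so
   [formal_sum] is meaningful on summable families only. *)
Definition summable_family (I : choiceType) (M : Type) (A : set I)
    (f : I -> M -> rat) : Prop :=
  forall m, finite_set [set i | A i /\ f i m != 0].

Definition formal_sum (I : choiceType) (M : Type) (A : set I)
    (f : I -> M -> rat) : M -> rat :=
  fun m => \sum_(i \in A) f i m.

(* A Laurent series in q over the rationals: s k is the coefficient of q^k. *)
Definition is_laurent (s : int -> rat) : Prop :=
  exists m : int, forall k, k < m -> s k = 0.

Definition qmono (N : nat) : int -> rat := fun k => (k == N%:Z)%:R.

Definition poly_laurent (p : {poly rat}) : int -> rat :=
  fun k => \sum_(i < size p) p`_i * qmono i k.

Definition mul_laurent (p : {poly rat}) (s : int -> rat) : int -> rat :=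
  fun k => \sum_(i < size p) p`_i * s (k - i%:Z).

(* s is the image of r under the embedding of Q(q) into the field Q((q)):
   the image of a / b is the Laurent series s such that b * s = a. *)
Definition laurent_expansion (r : ratfrac) (s : int -> rat) : Prop :=
  is_laurent s /\
  forall a b : {poly rat}, b != 0 -> r = to_ratfrac a / to_ratfrac b ->
    mul_laurent b s = poly_laurent a.

Section Coloring.
Variables (V : finType) (e : rel V).

Definition proper_coloring (C : eqType) (c : V -> C) : bool :=
  [forall v, forall w, e v w ==> (c v != c w)].

(* The colors 1, ..., n are the nonzero elements of 'I_n.+1. *)
Definition chi (lam : V -> nat) (n : nat) : {poly rat} :=
  \sum_(c : {ffun V -> 'I_n.+1} | [forall v, (0 < c v)%N] && proper_coloring c)
    'X^(\sum_v lam v * c v).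

Definition interpolates_chi (lam : V -> nat) (P : {poly ratfrac}) : Prop :=
  forall n, (0 < n)%N -> P.[qint n] = to_ratfrac (chi lam n).

(* See [chi_tildeP]: for positive weights there is exactly one such
   polynomial, so that the default value 0 is not used. *)
Definition chi_tilde (lam : V -> nat) : {poly ratfrac} :=
  xget 0 [set P | interpolates_chi lam P].

Definition positive_colorings : set {ffun V -> nat} :=
  [set c | (forall v, (0 < c v)%N) /\ proper_coloring c].

(* Monomials in x_0, x_1, x_2, ... are finitely supported exponent functions.
   No color is 0, hence x_0 does not occur in [chromatic_sym]. *)
Definition monomial := {fsfun nat -> nat with 0%N}.

(* x_1^#c^{-1}(1) x_2^#c^{-1}(2) ..., see [color_monomialE]. *)
Definition color_monomial (c : V -> nat) : monomial :=
  [fsfun i in [fset i in codom c]%fset => #|[set v | c v == i]%SET|].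

Definition chromatic_sym : monomial -> rat :=
  formal_sum positive_colorings (fun c a => (a == color_monomial c)%:R).

End Coloring.

(* The exponent of q in the image of a monomial under x_i |-> q^i. *)
Definition q_weight (a : monomial) : nat := (\sum_(i <- finsupp a) i * a i)%N.

(* F(q, q^2, q^3, ...) *)
Definition principal_spec (F : monomial -> rat) : int -> rat :=
  formal_sum setT (fun a k => F a * qmono (q_weight a) k).

Lemma color_monomialE (V : finType) (c : V -> nat) (i : nat) :
  color_monomial c i = #|[set v | c v == i]%SET|.
Proof.
rewrite /color_monomial fsfunE !inE.
case: ifP => // /negbT/codomP ci; apply/esym/eqP.
rewrite cards_eq0; apply/eqP/setP => v; rewrite !inE.
by apply/negP => /eqP cvi; apply: ci; exists v.
Qed.

Lemma qvar_neq0 : qvar != 0.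
Proof. by rewrite /qvar tofrac_eq0 polyX_eq0. Qed.

Lemma qvarX_neq1 n : (0 < n)%N -> 1 - qvar ^+ n != 0.
Proof.
move=> n0; rewrite -rmorphXn -(rmorph1 to_ratfrac) -rmorphB tofrac_eq0.
rewrite subr_eq0 eq_sym -subr_eq0 -size_poly_eq0 -[1]/(1%:P) size_XnsubC //.
Qed.

Lemma qvar_neq1 : 1 - qvar != 0.
Proof. exact: (@qvarX_neq1 1). Qed.

Lemma qvarX_inj : injective (fun n => qvar ^+ n).
Proof.
move=> m n /=; rewrite -!rmorphXn => /eqP; rewrite tofrac_eq => /eqP.
move=> /(congr1 (size : {poly rat} -> nat)).
by rewrite !size_polyXn => -[].
Qed.

Lemma qvarXE n : qvar ^+ n = 1 - (1 - qvar) * qint n.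
Proof. by rewrite /qint mulrCA mulfV ?qvar_neq1 // mulr1 opprB addrC subrK. Qed.

Lemma qint_inj : injective qint.
Proof. by move=> m n eq; apply: qvarX_inj => /=; rewrite !qvarXE eq. Qed.

Lemma interpolates_chi_unique (V : finType) (e : rel V) lam P P' :
  interpolates_chi e lam P -> interpolates_chi e lam P' -> P = P'.
Proof.
move=> PP PP'; apply/eqP; rewrite -subr_eq0; apply: contraT => nz.
pose s := [seq qint i.+1 | i <- iota 0 (size (P - P'))].
have := @max_poly_roots _ (P - P') s nz; rewrite size_map size_iota ltnn.
apply.
  apply/allP => x /mapP [i _ ->].
  by rewrite rootE !hornerE PP // PP' // subrr.
by rewrite map_inj_uniq ?iota_uniq // => i j /qint_inj [].
Qed.

(* Existence: deletion-contraction on the set S of active vertices, with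
   the list s of pairs that must get distinct colors; vertices outside
   S have color 0. *)
Section Existence.
Variable W : finType.

Let gen_ok (S : {set W}) (s : seq (W * W)) n (d : {ffun W -> 'I_n.+1}) :=
  [forall v, (v \in S) == (0 < d v)%N]
  && all (fun p => d p.1 != d p.2) s.

Let gen_sum (S : {set W}) (mu : W -> nat) s n : ratfrac :=
  \sum_(d : {ffun W -> 'I_n.+1} | gen_ok S s d)
     \prod_(v in S) qvar ^+ (mu v * d v).

Lemma geom_qint m n : (0 < m)%N ->
  \sum_(j : 'I_n.+1 | (0 < j)%N) qvar ^+ (m * j) =
  ((qvar ^+ m / (1 - qvar ^+ m))%:P *
     (1 - (1 - (1 - qvar)%:P * 'X) ^+ m)).[qint n].
Proof.
move=> m0; have := qvarXE n; move: (qint n) => x qx.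
rewrite !hornerE -qx -exprM mulnC exprM.
rewrite big_mkcond big_ord_recl /= add0r.
under eq_bigr do rewrite exprM exprS.
have nz := qvarX_neq1 m0; rewrite -mulr_sumr mulrAC -mulrA.
congr (_ * _); apply: (canRL (mulfK nz)).
by rewrite -[RHS]opprB subrX1 -mulNr opprB mulrC.
Qed.

Let gen_sum_nil (S : {set W}) mu : (forall v, v \in S -> (0 < mu v)%N) ->
  exists P : {poly ratfrac}, forall n, P.[qint n] = gen_sum S mu [::] n.
Proof.
move=> mu0.
exists (\prod_(v in S) ((qvar ^+ mu v / (1 - qvar ^+ mu v))%:P *
     (1 - (1 - (1 - qvar)%:P * 'X) ^+ mu v))) => n.
rewrite horner_prod /gen_sum.
rewrite (eq_bigl [in pffun_on ord0 (mem S) [pred j : 'I_n.+1 | (0 < j)%N]]); last first.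
  move=> d; rewrite /gen_ok andbT; apply/forallP/pfamilyP => [h|[sup im] v].
    split=> [|v vS]; last by rewrite inE -(eqP (h v)).
    by apply/fintype.subsetP => v; rewrite inE (eqP (h v)) lt0n.
  apply/eqP; apply/idP/idP => [vS|dv]; first exact: im.
  by apply: (fintype.subsetP sup); rewrite inE -lt0n in dv *.
rewrite -(big_distr_big ord0 (mem S) [pred j : 'I_n.+1 | (0 < j)%N]
  (fun v (j : 'I_n.+1) => qvar ^+ (mu v * j))) /=.
by apply: eq_bigr => v vS; rewrite -geom_qint // mu0.
Qed.

Let merge (a b : W) v := if v == b then a else v.

Let gen_sum_contract (S : {set W}) mu a b s n : a \in S -> b \in S -> a != b ->
  all (fun p => (p.1 \in S) && (p.2 \in S)) s ->
  \sum_(d : {ffun W -> 'I_n.+1} | gen_ok S s d && (d a == d b))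
     \prod_(v in S) qvar ^+ (mu v * d v) =
  gen_sum (S :\ b)%SET (fun v => if v == a then (mu a + mu b)%N else mu v)
    [seq (merge a b p.1, merge a b p.2) | p <- s] n.
Proof.
move=> aS bS ab sS; rewrite /gen_sum.
pose ext (d : {ffun W -> 'I_n.+1}) : {ffun W -> 'I_n.+1} :=
  [ffun v => d (merge a b v)].
pose res (d : {ffun W -> 'I_n.+1}) : {ffun W -> 'I_n.+1} :=
  [ffun v => if v == b then ord0 else d v].
rewrite (reindex_onto ext res) /=; last first.
  move=> d /andP [_ /eqP dab]; apply/ffunP => v; rewrite !ffunE /merge.
  by case: (eqVneq v b) => [->|vb]; rewrite ?(negbTE ab) ?(negbTE vb).
apply: eq_big => [d|d].
  rewrite /gen_ok all_map; apply/idP/idP.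
    move=> /andP [/andP [/andP [/forallP h ds] _] /eqP rd].
    apply/andP; split; last first.
      by apply/allP => p ps; have := allP ds p ps; rewrite /= !ffunE.
    apply/forallP => v; rewrite !inE; case: (eqVneq v b) => [->|vb] /=.
      by rewrite -rd ffunE eqxx.
    by have := h v; rewrite ffunE /merge (negbTE vb).
  move=> /andP [/forallP h ds].
  apply/andP; split; [apply/andP; split; [apply/andP; split|]|].
  - apply/forallP => v; rewrite ffunE /merge.
    case: (eqVneq v b) => [->|vb].
      by have := h a; rewrite !inE ab aS bS.
    by have := h v; rewrite !inE vb.
  - by apply/allP => p ps; have := allP ds p ps; rewrite /= !ffunE.
  - by rewrite !ffunE /merge eqxx (negbTE ab).
  apply/eqP/ffunP => v; rewrite !ffunE /merge.
  case: (eqVneq v b) => [->|//]; apply/val_inj/eqP => /=.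
  by have := h b; rewrite !inE eqxx /= eq_sym eqbF_neg -eqn0Ngt eq_sym.
move=> _; rewrite (bigD1 b) //= (bigD1 a) /=; last by rewrite aS.
rewrite [RHS](bigD1 a) /=; last by rewrite !inE ab.
rewrite eqxx !ffunE /merge eqxx (negbTE ab) mulrA -exprD -mulnDl addnC.
congr (_ * _); apply: eq_big => [v|v].
  by rewrite !inE; case: (v == b); rewrite ?andbF ?andbT.
by move=> /andP [/andP [_ vb] va]; rewrite ffunE /merge (negbTE va) (negbTE vb).
Qed.

Let gen_sum_poly (S : {set W}) mu s : (forall v, v \in S -> (0 < mu v)%N) ->
  all (fun p => (p.1 \in S) && (p.2 \in S)) s ->
  exists P : {poly ratfrac}, forall n, P.[qint n] = gen_sum S mu s n.
Proof.
move eqk: (size s) => k; elim: k S mu s eqk => [|k IH] S mu [|[a b] s] //=.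
  by move=> _ mu0 _; exact: gen_sum_nil.
move=> [sk] mu0 /andP [/andP [aS bS] sS].
have [<-|ab] := eqVneq a b.
  exists 0 => n; rewrite horner0 /gen_sum big1 // => d.
  by rewrite /gen_ok /= eqxx andbF.
have [P PE] := IH _ _ _ sk mu0 sS.
have [|||P' P'E] := IH (S :\ b)%SET (fun v => if v == a then (mu a + mu b)%N else mu v)
    [seq (merge a b p.1, merge a b p.2) | p <- s].
- by rewrite size_map.
- by move=> v; rewrite !inE => /andP [_ vS]; case: ifP => _; rewrite ?addn_gt0 ?mu0.
- have mS v : v \in S -> merge a b v \in (S :\ b)%SET.
    by rewrite /merge !inE; case: (eqVneq v b) => [|->]; rewrite ?ab.
  rewrite all_map; apply/allP => p ps; have /andP [p1 p2] := allP sS p ps.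
  by rewrite /= !mS.
exists (P - P') => n; rewrite hornerD hornerN PE P'E -gen_sum_contract //.
apply/eqP; rewrite subr_eq; apply/eqP.
rewrite {1}/gen_sum (bigID (fun d : {ffun W -> _} => d a == d b)) /= addrC.
congr (_ + _); apply: eq_bigl => d.
by rewrite /gen_ok /= -andbA [X in _ && X]andbC.
Qed.

Lemma interpolates_chi_exists (e : rel W) lam : (forall v, (0 < lam v)%N) ->
  exists P, interpolates_chi e lam P.
Proof.
move=> lam0.
have [||P PE] := @gen_sum_poly [set: W]%SET lam [seq p <- enum {: W * W} | e p.1 p.2].
- by move=> v _; exact: lam0.
- by apply/allP => p _; rewrite !inE.
exists P => n _; rewrite PE /chi rmorph_sum /=; apply: eq_big => [d|d _].
  rewrite /gen_ok; congr (_ && _).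
    by apply: eq_forallb => v; rewrite inE; case: (0 < d v)%N.
  apply/allP/forallP => [h v|h [v w]].
    apply/forallP => w; apply/implyP => evw.
    by apply: (h (v, w)); rewrite mem_filter evw mem_enum.
  rewrite mem_filter /= => /andP [evw _].
  by have /forallP/(_ w)/implyP := h v; exact.
rewrite rmorphXn /= expr_sum; apply: eq_bigl => v; by rewrite inE.
Qed.

End Existence.

Lemma chi_tildeP (V : finType) (e : rel V) (lam : V -> nat) :
  (forall v, (0 < lam v)%N) ->
  interpolates_chi e lam (chi_tilde e lam) /\
  (forall P, interpolates_chi e lam P -> P = chi_tilde e lam).
Proof.
move=> /(interpolates_chi_exists e) ex.
have h : interpolates_chi e lam (chi_tilde e lam) := xgetPex 0 ex.
by split=> // P PP; exact: interpolates_chi_unique PP h.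
Qed.

Lemma ratfracP (r : ratfrac) :
  exists a b : {poly rat}, b != 0 /\ r = to_ratfrac a / to_ratfrac b.
Proof.
elim/quotW: r => x; exists \n_x, \d_x; split; first exact: denom_ratioP.
have dx : to_ratfrac \d_x != 0 by rewrite tofrac_eq0 denom_ratioP.
apply: (canRL (mulfK dx)); rewrite /to_ratfrac !piE.
apply/eqP; rewrite piE /= /FracField.equivf /FracField.mulf.
by rewrite !numden_Ratio ?oner_eq0 ?mulr1 ?mul1r ?denom_ratioP //= mulrC.
Qed.

Lemma laurent_expansion_unique (r : ratfrac) s s' :
  laurent_expansion r s -> laurent_expansion r s' -> s = s'.
Proof.
move=> [[m sm] sE] [[m' sm'] s'E].
have [a [b [b0 rE]]] := ratfracP r.
have ss' : mul_laurent b s = mul_laurent b s' by rewrite (sE a) // (s'E a).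
have bex : exists i, b`_i != 0.
  by exists (size b).-1; rewrite -lead_coefE lead_coef_eq0.
pose j := ex_minn bex.
have [bj jmin] : b`_j != 0 /\ forall i, (i < j)%N -> b`_i = 0.
  rewrite /j; case: ex_minnP => j' bj' h; split=> // i ij.
  by apply/eqP; apply: contraTT ij => bi; rewrite -leqNgt h.
have jb : (j < size b)%N.
  by rewrite ltnNge; apply: contra bj => h; rewrite nth_default.
pose m0 : int := Num.min m m'.
suff H : forall n : nat, forall k : int, k < m0 + n%:Z -> s k = s' k.
  apply/funext => k; apply: (H `|k - m0|.+1); lia.
elim=> [|n IH] k kn.
  have [km km'] : k < m /\ k < m' by rewrite /m0 in kn; lia.
  by rewrite sm // sm'.
have [kn'|kn'] := ltP k (m0 + n%:Z); first exact: IH.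
have {kn kn'} kE : k = m0 + n%:Z by lia.
have := congr1 (fun f => f (k + j%:Z)) ss'; rewrite /mul_laurent.
rewrite (bigD1 (Ordinal jb)) //= [RHS](bigD1 (Ordinal jb)) //= !addrK.
rewrite [X in _ + X](_ : _ = \sum_(i < size b | i != Ordinal jb)
   b`_i * s' (k + j%:Z - i%:Z)); first by move/addIr/(mulfI bj).
apply: eq_bigr => i; rewrite -val_eqE /= => ij.
have [lt_ij|lt_ji|eq_ij] := ltngtP i j; first by rewrite jmin // !mul0r.
  by rewrite IH //; lia.
by rewrite eq_ij eqxx in ij.
Qed.

Section Summability.
Variables (V : finType) (e : rel V).

Lemma bounded_finite_set (A : set {ffun V -> nat}) m :
  (forall c, A c -> forall v, (c v <= m)%N) -> finite_set A.
Proof.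
move=> Am; pose f (d : {ffun V -> 'I_m.+1}) := [ffun v => val (d v)].
apply: (sub_finite_set (B := range f)); last exact/finite_image/finite_finset.
move=> c Ac; exists [ffun v => inord (c v)] => //.
by apply/ffunP => v; rewrite !ffunE /= inordK // ltnS Am.
Qed.

Lemma summable_qmono_coloring lam : (forall v, (0 < lam v)%N) ->
  summable_family (positive_colorings e)
    (fun c => qmono (\sum_v lam v * c v)%N).
Proof.
move=> lam0 k; apply: (@bounded_finite_set _ `|k|%N) => c [_].
rewrite /qmono pnatr_eq0 eqb0 negbK => /eqP -> v /=.
by rewrite (bigD1 v) //=; apply: leq_trans (leq_addr _ _); rewrite leq_pmull.
Qed.

Lemma summable_chromatic_sym :
  summable_family (positive_colorings e)
    (fun c (a : monomial) => (a == color_monomial c)%:R).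
Proof.
move=> a; apply: (@bounded_finite_set _ (\max_(i <- finsupp a) i)) => c [_].
rewrite pnatr_eq0 eqb0 negbK => /eqP -> v; apply: leq_bigmax_seq => //.
rewrite mem_finsupp color_monomialE -lt0n card_gt0; apply/set0Pn.
by exists v; rewrite inE.
Qed.

Lemma q_weight_color_monomial (c : V -> nat) :
  q_weight (color_monomial c) = (\sum_v c v)%N.
Proof.
rewrite /q_weight.
under eq_bigr => i _.
  rewrite color_monomialE -sum1_card big_distrr /=.
  under eq_bigl do rewrite inE.
  under eq_bigr => v cv do rewrite muln1 -(eqP cv).
  over.
rewrite (exchange_big_dep predT) //=; apply: eq_bigr => v _.
rewrite -big_filter (perm_big [:: c v]) ?big_seq1 //.
apply: uniq_perm => // [|i]; first by rewrite filter_uniq // fset_uniq.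
rewrite mem_filter inE eq_sym; case: eqP => //= ->.
rewrite mem_finsupp color_monomialE -lt0n card_gt0; apply/set0Pn.
by exists v; rewrite inE.
Qed.

Lemma chromatic_sym_neq0 a : chromatic_sym e a != 0 ->
  exists2 c, positive_colorings e c & a = color_monomial c.
Proof.
move=> a0; apply: contrapT => h; move/eqP: a0; apply.
rewrite /chromatic_sym /formal_sum fsbig1 // => c ec.
by case: eqP => // ac; case: h; exists c.
Qed.

Lemma summable_principal_spec :
  summable_family setT
    (fun a k => chromatic_sym e a * qmono (q_weight a) k).
Proof.
move=> k.
have := @summable_qmono_coloring (fun=> 1%N) (fun=> isT) k.
move=> /(finite_image (fun c : {ffun V -> nat} => color_monomial c)).
apply: sub_finite_set => a [_]; rewrite mulf_eq0 negb_or => /andP [/chromatic_sym_neq0].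
move=> [c ec ->]; rewrite q_weight_color_monomial => kc.
by exists c => //; split=> //; under eq_bigr do rewrite mul1n.
Qed.

End Summability.

(* Main.v *)
(** Let P be the polynomial with P([n]_q) = chi(q, n). As [n]_q = (1 - q^n) / (1 - q),
    the polynomial T(y) = P((1 - y) / (1 - q)) satisfies T(q^n) = chi(q, n) and
    T(0) = P(1 / (1 - q)). Clearing the denominators of T by some D in Q[q] gives
    D chi(q, n) = D P(1 / (1 - q)) modulo q^n in Q[q]. On the other hand chi(q, n)
    agrees up to degree n with the series over all colorings, and multiplication
    by D shifts q-adic valuations only by a constant, so n -> oo concludes. *)

Require Import Defs.
From mathcomp Require Import all_boot all_order all_algebra.
From mathcomp Require Import finmap boolp classical_sets.
From mathcomp Require Import functions cardinality fsbigop ring zify.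
Import GRing.Theory.
Local Open Scope ring_scope.

(** * Denominators and q-adic valuation *)

Lemma scale_common_denominator (F : fieldType) (p : {poly F}) (d a b c : F) :
  c * b = a ->
  (d * b) *: (p * 'X + c%:P) = b%:P * (d *: p) * 'X + (d * a)%:P.
Proof. by move=> <-; rewrite -!mul_polyC !polyCM; ring. Qed.

(** Horner induction: each new constant coefficient a / b multiplies the common denominator by b. *)
Lemma clear_denominators (T : {poly ratfrac}) :
  exists (D : {poly rat}) (U : {poly {poly rat}}),
    D != 0 /\ to_ratfrac D *: T = map_poly to_ratfrac U.
Proof.
elim/poly_ind: T => [|T c [D [U [D0 DT]]]].
  by exists 1, 0; rewrite oner_eq0 scaler0 rmorph0.
have [a [b [b0 cE]]] := ratfracP c.
have cb : c * to_ratfrac b = to_ratfrac a by rewrite cE divfK ?tofrac_eq0.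
exists (D * b), (b%:P * U * 'X + (D * a)%:P); rewrite mulf_neq0 //; split=> //.
rewrite (rmorphD (map_poly to_ratfrac)) !(rmorphM (map_poly to_ratfrac)).
rewrite /= map_polyX !map_polyC -DT (rmorphM to_ratfrac D b).
rewrite /= [to_ratfrac (D * a)](rmorphM to_ratfrac D a).
exact: scale_common_denominator.
Qed.

(** Here [j] is the multiplicity of 0 as a root of [D]; the cofactor [D'] has [D'](0) != 0, so it is
    coprime to every power of 'X. *)
Lemma dvdp_Xn_cancel (F : fieldType) (D : {poly F}) : D != 0 ->
  exists j, forall N (f : {poly F}), ('X^(j + N) %| D * f)%R -> ('X^N %| f)%R.
Proof.
move=> D0; have [j [D' /implyP/(_ D0) D'0 ->]] := multiplicity_XsubC D 0.
exists j => N f; rewrite subr0 mulrAC addnC exprD.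
rewrite dvdp_mul2r ?expf_neq0 ?polyX_eq0 // Gauss_dvdpr //.
by rewrite coprimep_expl // coprimep_sym coprimepX.
Qed.

Lemma poly_laurentE (a : {poly rat}) (k : nat) : poly_laurent a k = a`_k.
Proof.
rewrite /poly_laurent /qmono; case: (ltnP k (size a)) => [ka|ak].
  rewrite (bigD1 (Ordinal ka)) //= eqxx mulr1 big1 ?addr0 // => i ik.
  rewrite eqz_nat; case: eqP => [kE|_]; last by rewrite mulr0.
  by case/eqP: ik; apply: val_inj.
rewrite nth_default // big1 // => i _; rewrite eqz_nat.
by rewrite gtn_eqF ?mulr0 // (leq_trans (ltn_ord i)).
Qed.

Lemma poly_laurent_neg (a : {poly rat}) (k : int) : k < 0 -> poly_laurent a k = 0.
Proof.
move=> k0; apply: big1 => i _; rewrite /qmono.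
by case: eqP => [kE|_]; [move: k0; rewrite kE | rewrite mulr0].
Qed.

(** * Comparison of the coloring series with [chi] *)

Section Coefficients.
Variables (V : finType) (e : rel V) (lam : V -> nat).
Hypothesis lam_gt0 : forall v, (0 < lam v)%N.

Let coloring_series := formal_sum (positive_colorings e)
  (fun c => qmono (\sum_(v : V) lam v * c v)%N).

Lemma coloring_series_neg (k : int) : k < 0 -> coloring_series k = 0.
Proof.
move=> k0; apply: fsbig1 => c _; rewrite /qmono.
by case: eqP => // kE; move: k0; rewrite kE.
Qed.

(* Colorings using a color above n only contribute in degrees above n. *)
Lemma coloring_series_coef (n k : nat) : (k <= n)%N ->
  coloring_series k = (chi e lam n)`_k.
Proof.
move=> kn; rewrite /chi coef_sum.
pose C (d : {ffun V -> 'I_n.+1}) := [forall v, (0 < d v)%N] && proper_coloring e d.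
pose inj (d : {ffun V -> 'I_n.+1}) : {ffun V -> nat} := [ffun v => val (d v)].
have injK : injective inj.
  move=> d d' /ffunP dd'; apply/ffunP => v; apply: val_inj.
  by have := dd' v; rewrite !ffunE.
have properE d : proper_coloring e (inj d) = proper_coloring e d.
  apply: eq_forallb => v; apply: eq_forallb => w.
  by rewrite !ffunE.
rewrite /coloring_series /formal_sum -(fsbig_widen (inj @` [set` C])%classic).
- rewrite fsbig_image; last by move=> d d' _ _ /injK.
  rewrite [RHS]bigfs ?index_enum_uniq // => [|d _]; last by rewrite mem_index_enum.
  apply: eq_fsbigr => d _; rewrite coefXn /qmono.
  by under eq_bigr do rewrite ffunE.
- move=> _ [d /andP [/forallP d0 dP] <-]; split; last by rewrite properE.
  by move=> v; rewrite ffunE; exact: d0.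
move=> c [[c0 cP] nc] /=; rewrite /qmono; case: eqP => //= -[kE]; case: nc.
(* As every weight is at least 1, each color is at most the total exponent k <= n. *)
have cn v : (c v < n.+1)%N.
  rewrite ltnS (leq_trans _ kn) // kE (bigD1 v) //=.
  by apply: leq_trans (leq_addr _ _); rewrite leq_pmull.
have cE : inj [ffun v => Ordinal (cn v)] = c by apply/ffunP => v; rewrite !ffunE.
exists [ffun v => Ordinal (cn v)] => //; apply/andP; split.
  by apply/forallP => v; rewrite ffunE; exact: c0.
by rewrite -properE cE.
Qed.

Lemma mul_coloring_series (b : {poly rat}) (n k : nat) : (k <= n)%N ->
  mul_laurent b coloring_series k = (b * chi e lam n)`_k.
Proof.
move=> kn; rewrite coefM /mul_laurent.
(* Both sums are widened to a common range. The extra terms vanish: past [size b] because the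
   coefficient of [b] does, past k because the series has no negative degrees. *)
rewrite (big_ord_widen_cond _ xpredT (fun i => b`_i * coloring_series (k%:Z - i%:Z))
  (leq_maxl _ k.+1)).
rewrite (big_ord_widen_cond _ xpredT (fun i => b`_i * (chi e lam n)`_(k - i))
  (leq_maxr (size b) _)).
rewrite big_mkcond [RHS]big_mkcond; apply: eq_bigr => i _ /=.
case: ltnP => [ib|bi]; case: ltnP => // ik; last 1 first.
- by rewrite nth_default // mul0r.
- by rewrite subzn // (@coloring_series_coef n) // (leq_trans (leq_subr _ _)).
- rewrite coloring_series_neg ?mulr0 //; lia.
Qed.

Lemma mul_coloring_series_neg (b : {poly rat}) (k : int) : k < 0 ->
  mul_laurent b coloring_series k = 0.
Proof.
move=> k0; apply: big1 => i _; rewrite coloring_series_neg ?mulr0 //; lia.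
Qed.

Lemma chi_congr_mod_Xn : exists (D u : {poly rat}), [/\ D != 0,
    to_ratfrac D * (chi_tilde e lam).[1 / (1 - qvar)] = to_ratfrac u &
    forall n, (0 < n)%N -> ('X^n %| D * chi e lam n - u)%R].
Proof.
have [PE _] := chi_tildeP e lam_gt0; set P := chi_tilde e lam in PE *.
pose ell : {poly ratfrac} := (1 / (1 - qvar))%:P - (1 - qvar)^-1 *: 'X.
have [D [U [D0 DU]]] := clear_denominators (P \Po ell).
have UE y : to_ratfrac U.[y] =
    to_ratfrac D * P.[1 / (1 - qvar) - (1 - qvar)^-1 * to_ratfrac y].
  by rewrite -horner_map -DU hornerZ horner_comp !hornerE.
exists D, U.[0]; split=> // [|n n0]; first by rewrite UE rmorph0 mulr0 subr0.
have -> : D * chi e lam n = U.['X^n].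
  apply/eqP; rewrite -tofrac_eq; apply/eqP; rewrite -!/(to_ratfrac _).
  rewrite UE [LHS](rmorphM to_ratfrac) /= -PE // /qint mulrBl rmorphXn /=.
  by rewrite (mulrC (qvar ^+ n)).
(* The quotient [Q] has coefficients in Q[q], not merely in Q(q), so putting y = q^n in U(y) - U(0)
   = Q(y) y gives a divisibility in Q[q]. *)
have /factor_theorem [Q QE] : root (U - U.[0]%:P) 0.
  by rewrite rootE !hornerE subrr.
have := congr1 (horner^~ 'X^n) QE; rewrite !hornerE => ->.
by rewrite subr0 dvdp_mulIr.
Qed.

Lemma chi_tilde_expansion :
  laurent_expansion (chi_tilde e lam).[1 / (1 - qvar)] coloring_series.
Proof.
split=> [|a b b0 rE]; first by exists 0 => k; exact: coloring_series_neg.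
have [D [u [D0 uE cong]]] := chi_congr_mod_Xn.
have [j dvd] := dvdp_Xn_cancel _ _ D0.
(* Cross-multiplication of two fractions for the same value, u / D = a / b. *)
have bu : b * u = D * a.
  apply/eqP; rewrite -tofrac_eq -!/(to_ratfrac _) (rmorphM to_ratfrac b u).
  rewrite [to_ratfrac (D * a)](rmorphM to_ratfrac) /= -uE rE mulrCA.
  by rewrite [X in _ * X == _]mulrC divfK // tofrac_eq0.
apply/funext => -[] k; last by rewrite mul_coloring_series_neg ?poly_laurent_neg.
(* Cancelling [D] costs [j] powers of q; the remaining factor q^(k+1) kills the coefficient of
   degree k. *)
set n := (j + k.+1)%N.
rewrite (@mul_coloring_series b n) ?poly_laurentE; last by rewrite /n; lia.
apply/eqP; rewrite -subr_eq0 -coefB.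
have /dvd/dvdpP [f ->] : ('X^n %| D * (b * chi e lam n - a))%R.
  rewrite mulrBr -bu mulrCA -mulrBr dvdp_mull // cong //; rewrite /n; lia.
by rewrite mulrC coefXnM ltnS leqnn.
Qed.

End Coefficients.

(** Colorings are grouped by their monomial, whose [q_weight] is the sum of the colors. *)
Lemma principal_spec_chromatic_sym (V : finType) (e : rel V) :
  principal_spec (chromatic_sym e) =
  formal_sum (positive_colorings e) (fun c => qmono (\sum_(v : V) 1 * c v)%N).
Proof.
apply/funext => k; rewrite /principal_spec /formal_sum.
pose w (c : {ffun V -> nat}) := qmono (\sum_(v : V) 1 * c v)%N k.
(* Only the finitely many colorings in [A] contribute to degree k, which reduces the exchange of
   sums to a finite regrouping. *)
pose A := [set c | positive_colorings e c /\ w c != 0]%classic.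
have Afin : finite_set A := @summable_qmono_coloring V e (fun=> 1%N) (fun=> isT) k.
have sumA (F : {ffun V -> nat} -> rat) : (forall c, w c = 0 -> F c = 0) ->
    \sum_(c \in positive_colorings e) F c = \sum_(c <- fset_set A) F c.
  move=> F0; rewrite [RHS]fsbig_seq ?fset_uniq //; apply/esym/fsbig_widen.
    by move=> c /=; rewrite in_fset_set // inE => -[].
  move=> c [cP /negP]; rewrite /= in_fset_set // => cA; apply: F0.
  by apply: contraNeq cA => cw; rewrite inE.
have wE a (c : {ffun V -> nat}) :
    (a == color_monomial c)%:R * qmono (q_weight a) k =
    if color_monomial c == a then w c else 0.
  rewrite eq_sym; case: eqP => [<-|_]; last by rewrite mul0r.
  rewrite q_weight_color_monomial mul1r /w.
  by under [in RHS]eq_bigr do rewrite mul1n.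
rewrite [RHS]sumA //.
under eq_fsbigr => a _.
  rewrite /chromatic_sym /formal_sum mulr_fsuml sumA; last first.
    by move=> c cw; rewrite wE cw if_same.
  under eq_bigr do rewrite wE.
  rewrite -big_mkcond.
  over.
rewrite (partition_big_imfset _ (fun c : {ffun V -> nat} => color_monomial c)) /=.
(* A monomial outside the image of [A] has an empty fiber, so the sum over all monomials reduces to
   that image. *)
apply: fsbigTE => a /imfsetP aA; rewrite big_seq_cond big1 // => c /andP [cA /eqP ca].
by case: aA; exists c.
Qed.

Theorem theorem8 (V : finType) (e : rel V)
    (e_sym : symmetric e) (e_irr : irreflexive e)
    (lam : V -> nat) (lam_gt0 : forall v : V, (0 < lam v)%N) :
  laurent_expansion (chi_tilde e lam).[1 / (1 - qvar)]
    (formal_sum (positive_colorings e)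
       (fun c => qmono (\sum_(v : V) lam v * c v)%N))
  /\
  laurent_expansion (chi_tilde e (fun _ : V => 1%N)).[1 / (1 - qvar)]
    (principal_spec (chromatic_sym e)).
Proof.
split; first exact: chi_tilde_expansion.
by rewrite principal_spec_chromatic_sym; apply: chi_tilde_expansion.
Qed.
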